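(* Let $\Gamma=\mathrm{Cay}(\mathbb{Z}_n,S)$ be a connected $|S|$-regular graph, where $|S|$ is odd, $|S|\geq3$ and $n$ is even. Then $\Gamma$ contains no $(|S|,0)$-regular set.
   Context: $\mathbb{Z}_n$ denotes the cyclic group of order $n$, written multiplicatively, with identity $e$, and $S\subseteq\mathbb{Z}_n\setminus\{e\}$ is inverse-closed. The Cayley graph $\mathrm{Cay}(\mathbb{Z}_n,S)$ is the simple graph with vertex set $\mathbb{Z}_n$ in which $y$ and $z$ are adjacent if and only if $y^{-1}z\in S$. For a graph $\Gamma$ and nonnegative integers $a,b$, a nonempty proper subset $C$ of $V(\Gamma)$ is an $(a,b)$-regular set of $\Gamma$ if every vertex in $C$ has exactly $a$ neighbours in $C$ and every vertex in $V(\Gamma)\setminus C$ has exactly $b$ neighbours in $C$. *)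

(* Defs.v *)
From HB Require Import structures.
From mathcomp Require Import all_boot all_order all_fingroup all_solvable.
Set Implicit Arguments.
Unset Strict Implicit.
Unset Printing Implicit Defensive.
Local Open Scope group_scope.

Definition inverse_closed (gT : finGroupType) (S : {set gT}) : Prop :=
  forall x, x \in S -> x^-1 \in S.

(* A simple graph on T is given by its adjacency relation; for Cayley graphs,
   cayley_sym and cayley_irr show that this relation is symmetric and
   irreflexive. *)
Definition cayley (gT : finGroupType) (S : {set gT}) : rel gT :=
  fun y z => y^-1 * z \in S.

Definition neighbours_in (T : finType) (e : rel T) (C : {set T}) (x : T)
    : {set T} :=
  [set y in C | e x y].

Definition connected_graph (T : finType) (e : rel T) : Prop :=
  forall x y, connect e x y.

Definition regular_graph (T : finType) (e : rel T) (k : nat) : Prop :=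
  forall x, #|neighbours_in e [set: T] x| = k.

Definition regular_set (T : finType) (e : rel T) (a b : nat) (C : {set T})
    : Prop :=
  [/\ C != set0,
      C \proper [set: T],
      forall x, x \in C -> #|neighbours_in e C x| = a
    & forall x, x \notin C -> #|neighbours_in e C x| = b].

Lemma cayley_sym (gT : finGroupType) (S : {set gT}) :
  inverse_closed S -> symmetric (cayley S).
Proof.
move=> SV y z; rewrite /cayley.
by apply/idP/idP => /SV; rewrite invMg invgK.
Qed.

Lemma cayley_irr (gT : finGroupType) (S : {set gT}) :
  S \subset [set: gT] :\ 1 -> irreflexive (cayley S).
Proof.
move=> /subsetP S1 x; rewrite /cayley mulVg.
by apply/negP => /S1; rewrite !inE eqxx.
Qed.

(* Main.v *)
Require Import Defs.
From HB Require Import structures.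
From mathcomp Require Import all_boot all_order all_fingroup all_solvable.
Set Implicit Arguments.
Unset Strict Implicit.
Unset Printing Implicit Defensive.
Local Open Scope group_scope.

(** An (a, 0)-regular set [C] has no edge to its complement: an outside endpoint
    of such an edge would have a neighbour in [C]. Hence [C] is a union of
    connected components. In a connected graph the only nonempty such union is
    the whole vertex set, which is excluded since [C] is proper. *)

(** Symmetry of [e] is what turns the count of neighbours at outside vertices
    into a statement about edges leaving [C]. *)
Lemma regular_set0_closed (T : finType) (e : rel T) (a : nat) (C : {set T}) :
  symmetric e -> regular_set e a 0 C -> closed e C.
Proof.
move=> e_sym [_ _ _ C_out]; apply: (intro_closed (sym_connect_sym e_sym)).
move=> x y exy Cx; apply: contraT => /C_out/eqP.
by rewrite cards_eq0 => /eqP/setP/(_ x); rewrite !inE Cx e_sym exy.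
Qed.

Lemma connected_no_regular_set0 (T : finType) (e : rel T) (a : nat)
    (C : {set T}) :
  symmetric e -> connected_graph e -> ~ regular_set e a 0 C.
Proof.
move=> e_sym e_conn C_reg.
have C_closed := regular_set0_closed e_sym C_reg.
case: C_reg => /set0Pn[x Cx] /properP[_ [y _ /negP C'y]] _ _.
by apply: C'y; rewrite -(closed_connect C_closed (e_conn x y)).
Qed.

Theorem theorem5p6 (n : nat) (gT : finGroupType)
    (Zn_cyclic : cyclic [set: gT]) (Zn_order : #|[set: gT]| = n)
    (S : {set gT}) (S_non1 : S \subset [set: gT] :\ 1)
    (S_inv : inverse_closed S)
    (Gamma_connected : connected_graph (cayley S))
    (Gamma_regular : regular_graph (cayley S) #|S|)
    (S_odd : odd #|S|) (S_ge3 : 3 <= #|S|) (n_even : ~~ odd n) :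
  ~ exists C : {set gT}, regular_set (cayley S) #|S| 0 C.
Proof.
case=> C; exact: connected_no_regular_set0 (cayley_sym S_inv) Gamma_connected.
Qed.
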